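(* Let $\varphi$ be a sublinear metric-compatible function and $T\in\mathrm{Aut}(X,\mu)$ aperiodic. Then for every measurable $A\subseteq X$ and every integer $n\ge2$ there exists an $n$-cycle $P\in[T]_\varphi$ whose support $\{x:P(x)\ne x\}$ equals $A$ (up to null sets).
   Context: $(X,\mu)$ standard atomless probability space; $\mathrm{Aut}(X,\mu)$ measure-preserving transformations modulo null sets. For aperiodic $T$, $[T]$ is the set of $U\in\mathrm{Aut}(X,\mu)$ with $U(x)=T^{c_U(x)}(x)$ a.e. for a measurable $c_U:X\to\mathbb Z$. $\varphi:\mathbb R_+\to\mathbb R_+$ is metric-compatible if subadditive, non-decreasing, $\varphi(0)=0$, $\varphi(t)>0$ for $t>0$; sublinear if $\varphi(t)/t\to0$. $[T]_\varphi=\{U\in[T]:\int_X\varphi(|c_U|)d\mu<\infty\}$. An $n$-cycle ($n\ge2$) is a $P\in\mathrm{Aut}(X,\mu)$ all of whose orbits have cardinality $1$ or $n$ (almost surely). *)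

(* Defs.v *)
From HB Require Import structures.
From mathcomp Require Import all_boot all_order all_algebra.
From mathcomp Require Import all_classical all_reals all_analysis.
Set Implicit Arguments. Unset Strict Implicit. Unset Printing Implicit Defensive.
Import Order.TTheory GRing.Theory Num.Theory.
Import numFieldNormedType.Exports.
Local Open Scope classical_set_scope.
Local Open Scope ring_scope.

Definition iterZ {X : Type} (T S : X -> X) (k : int) : X -> X :=
  match k with
  | Posz m => iter m T
  | Negz m => iter m.+1 S
  end.

Definition mpreserving {d} {X : measurableType d} {R : realType}
  (mu : {measure set X -> \bar R}) (T : X -> X) : Prop :=
  measurable_fun setT T /\
  forall A : set X, measurable A -> mu (T @^-1` A) = mu A.

Definition ae_inverse {d} {X : measurableType d} {R : realType}
  (mu : {measure set X -> \bar R}) (T S : X -> X) : Prop :=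
  {ae mu, forall x, S (T x) = x} /\ {ae mu, forall x, T (S x) = x}.

Definition mp_inverse {d} {X : measurableType d} {R : realType}
  (mu : {measure set X -> \bar R}) (T S : X -> X) : Prop :=
  mpreserving mu S /\ ae_inverse mu T S.

(* T is (a representative of) an element of Aut(X, mu) *)
Definition isAut {d} {X : measurableType d} {R : realType}
  (mu : {measure set X -> \bar R}) (T : X -> X) : Prop :=
  mpreserving mu T /\ exists S, mp_inverse mu T S.

Definition orbitZ {X : Type} (T S : X -> X) (x : X) : set X :=
  [set iterZ T S k x | k in [set: int]].

Definition aperiodic {d} {X : measurableType d} {R : realType}
  (mu : {measure set X -> \bar R}) (T : X -> X) : Prop :=
  mpreserving mu T /\
  exists S, mp_inverse mu T S /\ {ae mu, forall x, infinite_set (orbitZ T S x)}.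

Definition n_cycle {d} {X : measurableType d} {R : realType}
  (mu : {measure set X -> \bar R}) (n : nat) (P : X -> X) : Prop :=
  isAut mu P /\
  exists S, mp_inverse mu P S /\
    {ae mu, forall x, (orbitZ P S x #= `I_1)%card \/ (orbitZ P S x #= `I_n)%card}.

Definition in_full_group_phi {d} {X : measurableType d} {R : realType}
  (mu : {measure set X -> \bar R}) (phi : R -> R) (T U : X -> X) : Prop :=
  isAut mu U /\
  exists S, mp_inverse mu T S /\
  exists c : X -> int,
    (forall k : int, measurable (c @^-1` [set k])) /\
    {ae mu, forall x, U x = iterZ T S (c x) x} /\
    (\int[mu]_x (phi (`|c x|%:~R))%:E < +oo)%E.

Definition metric_compatible {R : realType} (phi : R -> R) : Prop :=
  (forall t, 0 <= t -> 0 <= phi t) /\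
  (forall s t, 0 <= s -> 0 <= t -> phi (s + t) <= phi s + phi t) /\
  (forall s t, 0 <= s -> s <= t -> phi s <= phi t) /\
  phi 0 = 0 /\
  (forall t, 0 < t -> 0 < phi t).

Definition sublinear {R : realType} (phi : R -> R) : Prop :=
  (phi t / t) @[t --> +oo] --> 0.

(* standard Borel space: Borel isomorphic to the real line
   (every uncountable standard Borel space is) *)
Definition standard_borel {d} (X : measurableType d) (R : realType) : Prop :=
  exists (f : X -> R) (g : R -> X),
    measurable_fun setT f /\ measurable_fun setT g /\ cancel f g /\ cancel g f.

Definition atomless {d} {X : measurableType d} {R : realType}
  (mu : {measure set X -> \bar R}) : Prop :=
  forall A : set X, measurable A -> (0 < mu A)%E ->
    exists B : set X, [/\ measurable B, B `<=` A, (0 < mu B)%E & (mu B < mu A)%E].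

(* Main.v *)
Require Import Defs.
From HB Require Import structures.
From mathcomp Require Import all_boot all_order all_algebra.
From mathcomp Require Import all_classical all_reals all_analysis.
From mathcomp Require Import measurable_realfun.
From mathcomp Require Import zify ring.
Import Order.TTheory GRing.Theory Num.Theory.
Local Open Scope classical_set_scope.
Local Open Scope ring_scope.
Set Implicit Arguments.
Unset Strict Implicit.
Unset Printing Implicit Defensive.

(** Off an invariant null set, T is invertible and acts freely. For L measurable let U be
    the map that T induces on L, with return time a. By Kac, the integral of a is at most
    1, and sublinearity gives phi t <= h t + C(h) for every h > 0, so the integral of
    phi a is at most h + C(h) mu(L), which is small as soon as mu(L) is small.
    Cutting the U-orbits at a marker set B of small measure and grouping the points
    between two consecutive markers n by n yields an n-cycle supported on all of L except
    at most n - 1 points before each marker; its cocycle is a sum of at most n - 1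
    return times, so its cost is at most n (h + C(h) mu(L)).
    Start from A and repeat on the part left over: at step k the marker set of the previous
    step is chosen so small that the cost is O(2^-k). The supports are disjoint and exhaust
    A up to a null set, and the n-cycles glue to one of finite cost. *)

(** * Countably valued measurable functions *)

Lemma measurable_exists {d} {X : measurableType d} (C : countType)
    (Q : C -> X -> Prop) :
  (forall k, measurable [set x | Q k x]) -> measurable [set x | exists k, Q k x].
Proof.
move=> mQ.
suff -> : [set x | exists k, Q k x] = \bigcup_k [set x | Q k x].
  exact: countable_bigcupT_measurable.
by apply/seteqP; split=> x [k]; [exists k|move=> _; exists k].
Qed.

Lemma measurable_negation {d} {X : measurableType d} (Q : X -> Prop) :
  measurable [set x | Q x] -> measurable [set x | ~ Q x].
Proof. exact: measurableC. Qed.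

Lemma measurable_forall {d} {X : measurableType d} (C : countType)
    (Q : C -> X -> Prop) :
  (forall k, measurable [set x | Q k x]) -> measurable [set x | forall k, Q k x].
Proof.
move=> mQ.
suff -> : [set x | forall k, Q k x] = ~` [set x | exists k, ~ Q k x].
  by apply/measurableC/measurable_exists => k; exact: measurable_negation.
apply/seteqP; split=> x /= => [Qx [k]|/forallNP Qx k]; first by apply; exact: Qx.
exact: (contrapT (Qx k)).
Qed.

Lemma measurable_conj {d} {X : measurableType d} (Q Q' : X -> Prop) :
  measurable [set x | Q x] -> measurable [set x | Q' x] ->
  measurable [set x | Q x /\ Q' x].
Proof. exact: measurableI. Qed.

Lemma measurable_imply {d} {X : measurableType d} (Q Q' : X -> Prop) :
  measurable [set x | Q x] -> measurable [set x | Q' x] ->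
  measurable [set x | Q x -> Q' x].
Proof.
move=> mQ mQ'; suff -> : [set x | Q x -> Q' x] = ~` [set x | Q x] `|` [set x | Q' x].
  by apply: measurableU => //; exact: measurableC.
apply/seteqP; split=> x /= => [QQ|[]//].
by have [/QQ|] := pselect (Q x); [right|left].
Qed.

Lemma measurable_const {d} {X : measurableType d} (Q : Prop) :
  measurable [set x : X | Q].
Proof.
have [q|q] := pselect Q.
  by rewrite (_ : [set _ | _] = setT)//; apply/seteqP; split.
by rewrite (_ : [set _ | _] = set0)//; apply/seteqP; split.
Qed.

Lemma measurable_preimage {d d'} {X : measurableType d} {Y : measurableType d'}
    (f : X -> Y) (A : set Y) :
  measurable_fun setT f -> measurable A -> measurable [set x | A (f x)].
Proof. by move=> mf mA; rewrite -[X in measurable X]setTI; exact: mf. Qed.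

(** Asking only for measurable fibres spares the choice of a sigma-algebra on [C]. For countable [C]
    this is measurability for the discrete one; it serves for return times, levels and cocycles
    alike. *)
Definition cmeasurable {d} {X : measurableType d} {C : Type} (f : X -> C) :=
  forall k, measurable (f @^-1` [set k]).

Lemma cmeasurable_preimage {d} {X : measurableType d} {C : countType}
    (f : X -> C) (B : C -> Prop) :
  cmeasurable f -> measurable [set x | B (f x)].
Proof.
move=> mf; suff -> : [set x | B (f x)] = [set x | exists k, B k /\ f x = k].
  apply: measurable_exists => k; apply: measurable_conj; last exact: mf.
  exact: measurable_const.
by apply/seteqP; split=> x /= => [|[k [Bk ->//]]]; exists (f x).
Qed.

Lemma cmeasurable_comp {d} {X : measurableType d} {C D : countType}
    (h : C -> D) (f : X -> C) :
  cmeasurable f -> cmeasurable (h \o f).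
Proof. by move=> mf k; exact: (cmeasurable_preimage (fun c => h c = k)). Qed.

Lemma cmeasurable_precomp {d d'} {X : measurableType d} {Y : measurableType d'}
    {C : Type} (U : X -> Y) (f : Y -> C) :
  cmeasurable f -> measurable_fun setT U -> cmeasurable (f \o U).
Proof. by move=> mf mU k; exact: (measurable_preimage mU (mf k)). Qed.

Lemma cmeasurable_measurable {d d'} {X : measurableType d} {Y : measurableType d'}
    {C : countType} (h : C -> Y) (f : X -> C) :
  cmeasurable f -> measurable_fun setT (h \o f).
Proof.
move=> mf _ B _; rewrite setTI.
exact: (cmeasurable_preimage (fun c => B (h c))).
Qed.

Lemma cmeasurable_asbool {d} {X : measurableType d} (D : X -> Prop) :
  measurable [set x | D x] -> cmeasurable (fun x => `[< D x >]).
Proof.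
move=> mD [].
  suff -> : (fun x => `[< D x >]) @^-1` [set true] = [set x | D x] by [].
  by apply/seteqP; split=> x /=; [move/asboolP|move=> Dx; exact/asboolP].
suff -> : (fun x => `[< D x >]) @^-1` [set false] = ~` [set x | D x].
  exact: measurableC.
apply/seteqP; split=> x /= => [/negbT /asboolPn //|Dx].
by apply/negbTE/asboolPn.
Qed.

Lemma cmeasurable_glue {d} {X : measurableType d} {C : countType} {D : Type}
    (c : X -> C) (F : C -> X -> D) :
  cmeasurable c -> (forall k, cmeasurable (F k)) ->
  cmeasurable (fun x => F (c x) x).
Proof.
move=> mc mF y.
suff -> : (fun x => F (c x) x) @^-1` [set y] =
    [set x | exists k, c x = k /\ F k x = y].
  by apply: measurable_exists => k; apply: measurable_conj; [exact: mc|exact: mF].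
by apply/seteqP; split=> x /= => [<-|[k [<- ->//]]]; exists (c x).
Qed.

Lemma measurable_glue {d d'} {X : measurableType d} {Y : measurableType d'}
    {C : countType} (c : X -> C) (F : C -> X -> Y) :
  cmeasurable c -> (forall k, measurable_fun setT (F k)) ->
  measurable_fun setT (fun x => F (c x) x).
Proof.
move=> mc mF _ B mB; rewrite setTI.
suff -> : (fun x => F (c x) x) @^-1` B = [set x | exists k, c x = k /\ B (F k x)].
  apply: measurable_exists => k; apply: measurable_conj; first exact: mc.
  exact: measurable_preimage.
by apply/seteqP; split=> x /= => [Bx|[k [<- //]]]; exists (c x).
Qed.

Lemma cmeasurable_ite {d} {X : measurableType d} {D : Type}
    (Q : X -> Prop) (f g : X -> D) :
  measurable [set x | Q x] -> cmeasurable f -> cmeasurable g ->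
  cmeasurable (fun x => if `[< Q x >] then f x else g x).
Proof.
move=> mQ mf mg.
apply: (cmeasurable_glue (c := fun x => `[< Q x >])
  (F := fun (b : bool) x => if b then f x else g x)).
  exact: cmeasurable_asbool.
by case.
Qed.

Lemma measurable_ite {d d'} {X : measurableType d} {Y : measurableType d'}
    (Q : X -> Prop) (f g : X -> Y) :
  measurable [set x | Q x] -> measurable_fun setT f -> measurable_fun setT g ->
  measurable_fun setT (fun x => if `[< Q x >] then f x else g x).
Proof.
move=> mQ mf mg.
apply: (measurable_glue (c := fun x => `[< Q x >])
  (F := fun (b : bool) x => if b then f x else g x)).
  exact: cmeasurable_asbool.
by case.
Qed.

Lemma cmeasurable_const {d} {X : measurableType d} {C : Type} (c : C) :
  cmeasurable (fun _ : X => c).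
Proof. by move=> k; exact: measurable_const. Qed.

Lemma measurable_iter {d} {X : measurableType d} (T : X -> X) k :
  measurable_fun setT T -> measurable_fun setT (iter k T).
Proof.
move=> mT; elim: k => [|k IH] /=; first exact: measurable_id.
exact: measurableT_comp.
Qed.

(* The value is 0 when no natural number satisfies Q. *)
Definition least (Q : nat -> Prop) : nat :=
  if pselect (exists j, `[< Q j >]) is left e then ex_minn e else 0%N.

Lemma leastP (Q : nat -> Prop) : (exists j, Q j) ->
  Q (least Q) /\ forall i, (i < least Q)%N -> ~ Q i.
Proof.
move=> [j Qj]; rewrite /least; case: pselect => [e|]; last first.
  by case; exists j; exact/asboolP.
case: ex_minnP => m /asboolP Qm mmin; split=> // i im /asboolP /mmin.
by rewrite leqNgt im.
Qed.

Lemma least_eq (Q : nat -> Prop) k : Q k -> (forall i, (i < k)%N -> ~ Q i) ->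
  least Q = k.
Proof.
move=> Qk kmin; have [Ql lmin] := leastP (ex_intro Q k Qk).
by case: (ltngtP (least Q) k) => // [/kmin|/lmin].
Qed.

Lemma least0 (Q : nat -> Prop) : (forall j, ~ Q j) -> least Q = 0%N.
Proof.
move=> QN; rewrite /least; case: pselect => // e; exfalso.
by case: e => j /asboolP; exact: QN.
Qed.

Lemma cmeasurable_least {d} {X : measurableType d} (Q : nat -> X -> Prop) :
  (forall j, measurable [set x | Q j x]) -> cmeasurable (fun x => least (Q^~ x)).
Proof.
move=> mQ k.
suff -> : (fun x => least (Q^~ x)) @^-1` [set k] =
    [set x | Q k x /\ forall i, (i < k)%N -> ~ Q i x] `|`
    [set x | k = 0%N /\ forall j, ~ Q j x].
  apply: measurableU.
    apply: measurable_conj => //; apply: measurable_forall => i.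
    apply: measurable_imply; first exact: measurable_const.
    exact: measurable_negation.
  apply: measurable_conj; first exact: measurable_const.
  by apply: measurable_forall => i; exact: measurable_negation.
apply/seteqP; split=> x /=; last first.
  by case=> [[Qk kmin]|[-> QN]]; [exact: least_eq|exact: least0].
have [ex|/forallNP ex] := pselect (exists j, Q j x).
  by move=> <-; left; exact: leastP.
by move=> <-; right; rewrite least0.
Qed.

(** * Invertible measure-preserving maps *)

Lemma null_exists {d} {X : measurableType d} {R : realType} {C : countType}
    (mu : {measure set X -> \bar R}) (Q : C -> X -> Prop) :
  (forall k, measurable [set x | Q k x]) ->
  (forall k, mu [set x | Q k x] = 0%E) -> mu [set x | exists k, Q k x] = 0%E.
Proof.
move=> mQ Q0; apply/negligibleP; first exact: measurable_exists.
(* The countable type is enumerated by [unpickle]; integers that code nothing contribute the empty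
   set. *)
pose F n := [set x | if unpickle n is Some k then Q k x else False].
suff -> : [set x | exists k, Q k x] = \bigcup_n F n.
  apply: negligible_bigcup => n; rewrite /F; case: unpickle => [k|].
    by apply/negligibleP; [exact: mQ|exact: Q0].
  exact: negligible_set0.
apply/seteqP; split=> x [k]; first by exists (pickle k); rewrite // /F /= pickleK.
by move=> _; rewrite /F /=; case: unpickle => // l; exists l.
Qed.

Lemma null_setU {d} {X : measurableType d} {R : realType}
    (mu : {measure set X -> \bar R}) (A B : set X) :
  measurable A -> measurable B -> mu A = 0%E -> mu B = 0%E ->
  mu (A `|` B) = 0%E.
Proof. by move=> mA mB A0 B0; rewrite measureU0. Qed.

Lemma null_subset {d} {X : measurableType d} {R : realType}
    (mu : {measure set X -> \bar R}) (A B : set X) :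
  measurable A -> measurable B -> A `<=` B -> mu B = 0%E -> mu A = 0%E.
Proof. by move=> mA mB AB B0; exact: subset_measure0 AB B0. Qed.

(** The inverse relations hold at every point, so orbits are handled without exceptional sets. That
    [S] also preserves the measure is [pmp_pairC]. *)
Definition pmp_pair {d} {X : measurableType d} {R : realType}
    (mu : {measure set X -> \bar R}) (T S : X -> X) : Prop :=
  [/\ mpreserving mu T, measurable_fun setT S, cancel T S & cancel S T].

Lemma pmp_pairC {d} {X : measurableType d} {R : realType}
    (mu : {measure set X -> \bar R}) (T S : X -> X) :
  pmp_pair mu T S -> pmp_pair mu S T.
Proof.
move=> [[mT muT] mS TK SK]; split=> //; split=> // A mA.
rewrite -muT; last by rewrite -[X in measurable X]setTI; exact: mS.
by congr (mu _); apply/seteqP; split=> x /=; rewrite TK.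
Qed.

Lemma iter_cancel {X : Type} (T S : X -> X) k :
  cancel T S -> cancel (iter k T) (iter k S).
Proof. by move=> TK; elim: k => // k IH x; rewrite iterSr iterS TK IH. Qed.

Lemma pmp_pair_iter {d} {X : measurableType d} {R : realType}
    (mu : {measure set X -> \bar R}) (T S : X -> X) k :
  pmp_pair mu T S -> pmp_pair mu (iter k T) (iter k S).
Proof.
move=> [[mT muT] mS TK SK]; split; [split| | |].
- exact: measurable_iter.
- elim: k => // k IH A mA /=.
  have := IH (T @^-1` A); rewrite muT// => <- //.
  by rewrite -[X in measurable X]setTI; exact: mT.
- exact: measurable_iter.
- exact: iter_cancel.
- exact: iter_cancel.
Qed.

Lemma pmp_pair_iterZ {d} {X : measurableType d} {R : realType}
    (mu : {measure set X -> \bar R}) (T S : X -> X) k :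
  pmp_pair mu T S -> pmp_pair mu (iterZ T S k) (iterZ S T k).
Proof.
move=> TS; case: k => k /=; first exact: pmp_pair_iter.
exact: (pmp_pair_iter k.+1 (pmp_pairC TS)).
Qed.

(** Adjoining preimages under both maps countably many times keeps the set null and makes its
    complement invariant. *)
Lemma null_saturation {d} {X : measurableType d} {R : realType}
    (mu : {measure set X -> \bar R}) (T S : X -> X) (N : set X) :
  mpreserving mu T -> mpreserving mu S -> measurable N -> mu N = 0%E ->
  exists N' : set X, [/\ measurable N', mu N' = 0%E, N `<=` N' &
    forall x, ~ N' x -> ~ N' (T x) /\ ~ N' (S x)].
Proof.
move=> [mT muT] [mS muS] mN N0.
pose F := fix F i : set X :=
  if i is j.+1 then F j `|` (T @^-1` F j `|` S @^-1` F j) else N.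
have mpre (U : X -> X) (B : set X) :
    measurable_fun setT U -> measurable B -> measurable (U @^-1` B).
  by move=> mU mB; exact: measurable_preimage.
have mF i : measurable (F i).
  elim: i => //= i IH; apply: measurableU => //.
  by apply: measurableU; exact: mpre.
have F0 i : mu (F i) = 0%E.
  elim: i => //= i IH; apply: null_setU => //.
    by apply: measurableU; exact: mpre.
  by apply: null_setU; rewrite ?muT ?muS//; exact: mpre.
exists [set x | exists i, F i x]; split.
- exact: measurable_exists.
- exact: null_exists.
- by move=> x Nx; exists 0%N.
- by move=> x NF; split=> -[i Fi]; apply: NF; exists i.+1 => /=; right; [left|right].
Qed.

(** * Wandering sets and recurrence *)

Lemma sum_trivIset_le {d} {X : measurableType d} {R : realType}
    (mu : probability X R) (F : nat -> set X) :
  (forall k, measurable (F k)) ->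
  (forall i j x, (i < j)%N -> F i x -> F j x -> False) ->
  (\sum_(k <oo) mu (F k) <= 1)%E.
Proof.
move=> mF dF; rewrite -measure_semi_bigcup//.
- by apply: probability_le1; exact: bigcupT_measurable.
- move=> i j _ _ [x [Fi Fj]].
  by case: (ltngtP i j) => // ij; exfalso; [exact: (dF i j x)|exact: (dF j i x)].
- exact: bigcupT_measurable.
Qed.

(** The preimages of [W] under the iterates of [T] are pairwise disjoint and of equal measure, while
    their total measure is at most 1. *)
Lemma wandering_null {d} {X : measurableType d} {R : realType}
    (mu : probability X R) (T : X -> X) (W : set X) :
  mpreserving mu T -> measurable W ->
  (forall x j, W x -> W (iter j.+1 T x) -> False) -> mu W = 0%E.
Proof.
move=> [mT muT] mW wW.
have mF k : measurable [set x | W (iter k T x)].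
  by apply: measurable_preimage => //; exact: measurable_iter.
have muF k : mu [set x | W (iter k T x)] = mu W.
  elim: k => //= k <-; rewrite -(muT _ (mF k)); congr (mu _).
  by apply/seteqP; split=> x /=; rewrite -iterSr.
have := sum_trivIset_le mu mF.
have dF i j x : (i < j)%N -> W (iter i T x) -> W (iter j T x) -> False.
  move=> ij Wi; rewrite -(subnK ij) addnS -addSn iterD; exact: wW.
move=> /(_ dF); apply: contraPP => W0.
have {}W0 : (0 < mu W)%E by rewrite lt0e measure_ge0 andbT; exact/eqP.
under eq_eseriesr do rewrite muF.
have fW : mu W \is a fin_num by exact: fin_num_measure.
apply/negP; rewrite -ltNge.
(* More than [1 / mu W] terms already push the sum above 1. *)
pose m := (Num.truncn (fine (mu W))^-1).+1.
apply: (@lt_le_trans _ _ (\sum_(0 <= k < m) mu W)%E); last first.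
  by apply: nneseries_lim_ge => n _ _; exact: measure_ge0.
rewrite -(fineK fW) sumEFin sumr_const_nat subn0 lte_fin.
rewrite -mulr_natl -ltr_pdivrMr ?div1r; last by rewrite fine_gt0// W0 ltey_eq fW.
by rewrite /m; exact: truncnS_gt.
Qed.

(** Poincaré recurrence in both time directions, made pointwise: the points of [L] that never return
    form wandering sets. After removal of an invariant null set containing them, a return to [L] is
    a return to what remains. *)
Lemma recurrent_part {d} {X : measurableType d} {R : realType}
    (mu : probability X R) (T S : X -> X) (L : set X) :
  pmp_pair mu T S -> measurable L ->
  exists L0 : set X, [/\ measurable L0, L0 `<=` L, mu (L `\` L0) = 0%E,
    (forall x, L0 x -> exists j, L0 (iter j.+1 T x)) &
    (forall x, L0 x -> exists j, L0 (iter j.+1 S x))].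
Proof.
move=> TS mL.
have norec U V : pmp_pair mu U V ->
    let W := [set x | L x /\ forall j, ~ L (iter j.+1 U x)] in
    measurable W /\ mu W = 0%E.
  move=> [mpU _ _ _] W; have mW : measurable W.
    apply: measurable_conj => //; apply: measurable_forall => j.
    apply: measurable_negation; apply: measurable_preimage => //.
    by apply: measurable_iter; case: mpU.
  by split=> //; apply: (wandering_null mpU) => // x j [_ /(_ j)] ? [].
have [m1 n1] := norec _ _ TS; have [m2 n2] := norec _ _ (pmp_pairC TS).
have mpT : mpreserving mu T by case: TS.
have mpS : mpreserving mu S by case: (pmp_pairC TS).
have [N [mN N0 sN iN]] := null_saturation mpT mpS
  (measurableU _ _ m1 m2) (null_setU m1 m2 n1 n2).
have sub0 U V : pmp_pair mu U V ->
    [set x | L x /\ forall j, ~ L (iter j.+1 U x)] `<=` N ->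
    (forall y, ~ N y -> ~ N (U y)) ->
    forall x, (L `\` N) x -> exists j, (L `\` N) (iter j.+1 U x).
  move=> UV WN NU x [Lx Nx]; apply: contrapT => /forallNP NL.
  apply/Nx/WN; split=> // j Lj; apply: (NL j); split=> //.
  by elim: j.+1 => //= i; exact: NU.
exists (L `\` N); split.
- exact: measurableD.
- by move=> x [].
- apply: (null_subset _ mN _ N0); first by do 2 apply: measurableD => //.
  by move=> x [Lx] /not_andP[//|/contrapT].
- apply: (sub0 _ _ TS) => [x Wx|y /iN[]//].
  by apply: sN; left.
- apply: (sub0 _ _ (pmp_pairC TS)) => [x Wx|y /iN[]//].
  by apply: sN; right.
Qed.

(** Sort the source by [c] and the target by [c] of its preimage. On each piece [U] is a single map
    [G k], which preserves the measure; bijectivity of [U] makes the pieces of the target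
    disjoint. *)
Lemma piecewise_pmp {d} {X : measurableType d} {R : realType} {C : countType}
    (mu : {measure set X -> \bar R}) (G H : C -> X -> X) (c : X -> C) (U V : X -> X) :
  (forall k, pmp_pair mu (G k) (H k)) -> cmeasurable c ->
  (forall x, U x = G (c x) x) -> cancel U V -> cancel V U -> pmp_pair mu U V.
Proof.
move=> GH mc UE UK VK.
have mG k : measurable_fun setT (G k) by case: (GH k) => -[].
have mH k : measurable_fun setT (H k) by case: (GH k).
have GK k : cancel (G k) (H k) by case: (GH k).
have HK k : cancel (H k) (G k) by case: (GH k).
have cV y : H (c (V y)) y = V y by rewrite -[X in H _ X]VK UE GK.
have cH k y : c (H k y) = k -> V y = H k y.
  by move=> ck; apply: (can_inj UK); rewrite VK UE ck HK.
have mcH k : measurable [set y | c (H k y) = k].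
  exact: (measurable_preimage (mH k) (mc k)).
have mU : measurable_fun setT U.
  by rewrite (funext UE : U = _); exact: measurable_glue.
have mV : measurable_fun setT V.
  move=> _ A mA; rewrite setTI.
  suff -> : V @^-1` A = [set y | exists k, c (H k y) = k /\ A (H k y)].
    apply: measurable_exists => k; apply: measurable_conj => //.
    exact: measurable_preimage.
  apply/seteqP; split=> y /= => [AV|[k [ck]]]; last by rewrite (cH k y ck).
  by exists (c (V y)); rewrite cV.
split=> //; split=> // A mA.
have mUA : measurable (U @^-1` A) by exact: measurable_preimage.
pose F n := [set x | pickle (c x) = n /\ A (U x)].
pose B n := [set y | pickle (c (V y)) = n /\ A y].
have mcV : cmeasurable (c \o V) by exact: cmeasurable_precomp.
have mF n : measurable (F n).
  by apply: measurable_conj => //; exact: (cmeasurable_preimage (fun k => pickle k = n)).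
have mB n : measurable (B n).
  by apply: measurable_conj => //; exact: (cmeasurable_preimage (fun k => pickle k = n) mcV).
have -> : U @^-1` A = \bigcup_n F n.
  by apply/seteqP; split=> x => [Ax|[n _ []]//]; exists (pickle (c x)).
have -> : A = \bigcup_n B n.
  by apply/seteqP; split=> x => [Ax|[n _ []]//]; exists (pickle (c (V x))).
rewrite !measure_semi_bigcup//; do ?[exact: bigcupT_measurable|
  by move=> i j _ _ [x /= [[<- _] [<- _]]]].
apply: eq_eseriesr => n _.
(* When [n] codes no element of [C], both pieces are empty. *)
have [[k kn]|kn] := pselect (exists k : C, pickle k = n); last first.
  congr (mu _); apply/seteqP; split=> x [cx _]; exfalso; apply: kn;
  by [exists (c x)|exists (c (V x))].
have [mGk muG] : mpreserving mu (G k) by case: (GH k).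
rewrite -(muG _ (mB n)); congr (mu _).
apply/seteqP; split=> x; rewrite /F /B /= -kn.
  by move=> [/(pcan_inj pickleK) ck AU]; rewrite -ck -UE UK.
move=> [/(pcan_inj pickleK) ck AG]; have := cV (G k x); rewrite ck GK => xE.
have cx : c x = k by rewrite xE.
by rewrite UE cx.
Qed.

(** * Return times, induced maps and Kac's inequality *)

Definition recurrent {X : Type} (T : X -> X) (L : set X) : Prop :=
  forall x, L x -> exists j, L (iter j.+1 T x).

(* Equal to 0 outside L, so that the induced map fixes ~` L. *)
Definition return_time {X : Type} (T : X -> X) (L : set X) (x : X) : nat :=
  least (fun j => [/\ (0 < j)%N, L x & L (iter j T x)]).

Definition induced_map {X : Type} (T : X -> X) (L : set X) (x : X) : X :=
  iter (return_time T L x) T x.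

Lemma return_timeP {X : Type} (T : X -> X) (L : set X) x :
  recurrent T L -> L x ->
  [/\ (0 < return_time T L x)%N, L (induced_map T L x) &
    forall i, (0 < i < return_time T L x)%N -> ~ L (iter i T x)].
Proof.
move=> rL Lx; have [j Lj] := rL x Lx.
have [[a0 _ La] amin] := leastP (ex_intro (fun j =>
  [/\ (0 < j)%N, L x & L (iter j T x)]) j.+1 (And3 isT Lx Lj)).
by split=> // i /andP[i0 /amin im] Li; exact: im.
Qed.

Lemma return_time_gt0 {X : Type} (T : X -> X) (L : set X) x :
  (0 < return_time T L x)%N -> L x.
Proof.
by move=> r0; apply: contrapT => Lx; move: r0; rewrite /return_time least0// => j [].
Qed.

Lemma return_time_out {X : Type} (T : X -> X) (L : set X) x :
  ~ L x -> return_time T L x = 0%N.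
Proof. by move=> Lx; apply: least0 => j []. Qed.

Lemma induced_map_out {X : Type} (T : X -> X) (L : set X) x :
  ~ L x -> induced_map T L x = x.
Proof. by move=> Lx; rewrite /induced_map return_time_out. Qed.

Lemma iter_cancelB {X : Type} (T S : X -> X) i m x : cancel T S -> (i <= m)%N ->
  iter i S (iter m T x) = iter (m - i) T x.
Proof.
move=> TK im; rewrite -{1}(subnKC im) iterD.
exact: (iter_cancel i TK).
Qed.

(** The path from [x] to its first return has no intermediate point in [L], so read backwards it is
    the first return under [S], with the same length. *)
Lemma induced_map_cancel {X : Type} (T S : X -> X) (L : set X) :
  cancel T S -> recurrent T L -> cancel (induced_map T L) (induced_map S L).
Proof.
move=> TK rL x; have [Lx|Lx] := pselect (L x); last by rewrite !induced_map_out.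
have [a0 La amin] := return_timeP rL Lx.
suff aE : return_time S L (induced_map T L x) = return_time T L x.
  by rewrite {1}/induced_map aE; exact: (iter_cancel _ TK).
apply: least_eq; first by split=> //; rewrite iter_cancel.
move=> i ia [i0 _]; rewrite iter_cancelB ?(ltnW ia)//; apply: amin.
by rewrite subn_gt0 ia ltn_subrL i0.
Qed.

Lemma cmeasurable_return_time {d} {X : measurableType d} (T : X -> X) (L : set X) :
  measurable_fun setT T -> measurable L -> cmeasurable (return_time T L).
Proof.
move=> mT mL; apply: cmeasurable_least => j.
suff -> : [set x | [/\ (0 < j)%N, L x & L (iter j T x)]] =
    [set x | (0 < j)%N /\ (L x /\ L (iter j T x))].
  apply: measurable_conj; first exact: measurable_const.
  apply: measurable_conj => //; apply: measurable_preimage => //.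
  exact: measurable_iter.
by apply/seteqP; split=> x [] // ? [].
Qed.

Lemma pmp_pair_induced {d} {X : measurableType d} {R : realType}
    (mu : {measure set X -> \bar R}) (T S : X -> X) (L : set X) :
  pmp_pair mu T S -> measurable L -> recurrent T L -> recurrent S L ->
  pmp_pair mu (induced_map T L) (induced_map S L).
Proof.
move=> TS mL rT rS; have [[mT _] mS TK SK] := TS.
apply: (piecewise_pmp (G := fun k => iter k T) (H := fun k => iter k S)
  (c := return_time T L)) => //.
- by move=> k; exact: pmp_pair_iter.
- exact: cmeasurable_return_time.
- exact: induced_map_cancel.
- exact: induced_map_cancel.
Qed.

Lemma iter_piecewise {X : Type} (T U : X -> X) (a : X -> nat) j x :
  (forall y, U y = iter (a y) T y) ->
  iter j U x = iter (\sum_(i < j) a (iter i U x)) T x.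
Proof.
move=> UE; elim: j => [|j IH]; first by rewrite big_ord0.
by rewrite iterS UE big_ord_recr /= addnC iterD -IH.
Qed.

Lemma induced_map_free {X : Type} (T : X -> X) (L : set X) x j :
  recurrent T L -> (forall y i, L y -> iter i.+1 T y <> y) ->
  L x -> iter j.+1 (induced_map T L) x <> x.
Proof.
move=> rL fL Lx.
have -> := iter_piecewise (T := T) (U := induced_map T L) j.+1 x (fun=> erefl).
have [a0 _ _] := return_timeP rL Lx.
rewrite big_ord_recl /= -(prednK a0) addSn.
exact: fL.
Qed.

(** The integral is the sum of the measures of the levels of the skyscraper over [L]. Moved up by
    [j] steps, the sets where [j < a] become disjoint: a point above two bases would give the lower
    base a return earlier than its return time. *)
Lemma kac {d} {X : measurableType d} {R : realType}
    (mu : probability X R) (T S : X -> X) (L : set X) :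
  pmp_pair mu T S -> measurable L -> recurrent T L ->
  (\int[mu]_x (return_time T L x)%:R%:E <= 1)%E.
Proof.
move=> TS mL rL; have [[mT _] mS TK SK] := TS.
set a := return_time T L; have ma : cmeasurable a by exact: cmeasurable_return_time.
have mD j : measurable [set x | (j < a x)%N].
  exact: (cmeasurable_preimage (fun k => (j < k)%N : Prop)).
(* The return time counts the levels strictly below it. *)
have aE x : (a x)%:R%:E = (\sum_(j <oo) (\1_[set x | (j < a x)%N] x : R)%:E)%E.
  rewrite (nneseries_split 0 (a x)); last by move=> k _; rewrite lee_fin.
  rewrite add0n eseries0 ?adde0; last first.
    by move=> k ak _; rewrite indicE memNset//= => ka; move: ak; rewrite leqNgt ka.
  rewrite big_nat (eq_bigr (fun=> 1%:E)); last first.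
    by move=> k /andP[_ ka]; rewrite indicE mem_set.
  by rewrite -big_nat sumEFin sumr_const_nat subn0.
under eq_integral do rewrite aE.
rewrite integral_nneseries//; last first.
- by move=> j; apply/measurable_EFinP; exact: measurable_indic.
pose F j := [set y | (j < a (iter j S y))%N].
have mF j : measurable (F j).
  by apply: (measurable_preimage (measurable_iter j mS) (mD j)).
rewrite (eq_eseriesr (g := fun j => mu (F j))); last first.
  move=> j _; rewrite integral_indic// setIT.
  by have [[_ muS] _ _ _] := pmp_pair_iter j (pmp_pairC TS); rewrite -muS.
apply: sum_trivIset_le => // i j y ij ia ja.
have Li : L (iter i S y) by exact: return_time_gt0 (leq_ltn_trans (leq0n _) ia).
have [_ _ jmin] := return_timeP rL (return_time_gt0 (leq_ltn_trans (leq0n _) ja)).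
apply: (jmin (j - i)%N).
  by rewrite subn_gt0 ij/=; apply: leq_ltn_trans ja; exact: leq_subr.
by rewrite -{2}(subnK (ltnW ij)) iterD (iter_cancel _ SK).
Qed.

(* Let W be the set of points where f is minimal along the backward orbit. Successive
   visits of an orbit to W strictly decrease f, so cutting at rational levels writes W as
   a countable union of wandering sets. Hence W is null, and the sets of almost minimal
   points, which decrease to W, have arbitrarily small measure. *)
Lemma small_marker {d} {X : measurableType d} {R : realType}
    (mu : probability X R) (U V : X -> X) (L : set X) (f : X -> R) (e : R) :
  pmp_pair mu U V -> measurable L ->
  (forall x, L x -> L (V x)) -> (forall x j, L x -> iter j.+1 U x <> x) ->
  measurable_fun setT f -> injective f -> (forall x, 0 <= f x) -> 0 < e ->
  exists B : set X, [/\ measurable B, (mu B <= e%:E)%E &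
    forall x, L x -> exists j, B (iter j V x)].
Proof.
move=> UV mL LV fL mf injf f0 e0; have [[mU muU] mV UK VK] := UV.
have mle (g h : X -> R) : measurable_fun setT g -> measurable_fun setT h ->
    measurable [set x | g x <= h x].
  by move=> mg mh; rewrite -[X in measurable X]setTI; exact: measurable_fun_le.
have mfV j : measurable_fun setT (fun x => f (iter j V x)).
  by apply: measurableT_comp => //; exact: measurable_iter.
have mfU j : measurable_fun setT (fun x => f (iter j U x)).
  by apply: measurableT_comp => //; exact: measurable_iter.
pose B k := [set x | L x /\ forall j, f x <= f (iter j V x) + k.+1%:R^-1].
pose W := [set x | L x /\ forall j, f x <= f (iter j V x)].
have mB k : measurable (B k).
  apply: measurable_conj => //; apply: measurable_forall => j; apply: mle => //.
  exact: measurable_funD.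
have mW : measurable W.
  by apply: measurable_conj => //; apply: measurable_forall => j; exact: mle.
have mWU j : measurable [set x | W (iter j U x)].
  by apply: measurable_preimage => //; exact: measurable_iter.
(* The last visit to [W] with value at least [q]: an orbit meets this set at most once. *)
pose Wq (q : rat) := [set x | W x /\ (ratr q <= f x /\
  forall j, W (iter j.+1 U x) -> ~ (ratr q <= f (iter j.+1 U x)))].
have mWq q : measurable (Wq q).
  apply: measurable_conj => //; apply: measurable_conj; first exact: mle.
  apply: measurable_forall => j; apply: measurable_imply; first exact: (mWU j.+1).
  by apply: measurable_negation; apply: mle => //; exact: (mfU j.+1).
have Wq0 q : mu (Wq q) = 0%E.
  apply: (wandering_null (T := U)) => // x j [_ [_ /(_ j) H]] [Wj [qj _]].
  exact: H.
have W0 : mu W = 0%E.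
  apply: (null_subset mW (B := [set x | exists q, Wq q x])).
  - exact: measurable_exists.
  - move=> x Wx; have [ret|/forallNP noret] := pselect (exists j, W (iter j.+1 U x)).
      have [Wj jmin] := leastP ret; set j := least _ in Wj jmin.
      have /rat_in_itvoo[q] : f (iter j.+1 U x) < f x.
        rewrite lt_neqAle; apply/andP; split.
          by apply/eqP => /injf; apply: fL; case: Wx.
        by have := Wj.2 j.+1; rewrite (iter_cancel _ UK).
      rewrite in_itv/= => /andP[jq qx]; exists q; split=> //; split; first exact: ltW.
      move=> i Wi; apply/negP; rewrite -ltNge; apply: le_lt_trans jq.
      have ji : (j <= i)%N by rewrite leqNgt; apply/negP => /jmin; exact.
      have := Wi.2 (i - j)%N; rewrite iter_cancelB//; last by rewrite leqW// leq_subr.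
      by rewrite subSn ?leq_subr// subKn.
    (* Without a later visit to [W] any level below [f x] works, and [f] is non-negative. *)
    exists 0; split=> //; split; first by rewrite raddf0.
    by move=> j /noret.
  - exact: null_exists.
have BW : \bigcap_k B k = W.
  apply/seteqP; split=> x.
    move=> Bx; split=> [|j]; first by have [] := Bx 0%N I.
    apply/ler_addgt0Pr => t t0.
    have [k kt] : exists k, k.+1%:R^-1 < t.
      exists (Num.truncn t^-1); rewrite -[ltRHS]invrK ltf_pV2 ?posrE ?invr_gt0//.
      exact: truncnS_gt.
    by have [_ /(_ j) Bk] := Bx k I; apply: le_trans Bk _; rewrite lerD2l ltW.
  by move=> [Lx Wx] k _; split=> // j; apply: le_trans (Wx j) _; rewrite lerDl.
have : mu \o B @ \oo --> mu (\bigcap_k B k).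
  apply: nonincreasing_cvg_mu => //.
  - by rewrite ltey_eq fin_num_measure.
  - by rewrite BW.
  - move=> m n mn; apply/subsetPset => x [Lx Bx]; split=> // j.
    by apply: le_trans (Bx j) _; rewrite lerD2l lef_pV2 ?posrE// ler_nat.
rewrite BW W0 => /fine_cvgP[_ /cvgrPdist_lt /(_ e e0)] [N _ /(_ N (leqnn N))] /=.
rewrite sub0r normrN => muN.
exists (B N); split=> //.
  rewrite -[leLHS]fineK ?fin_num_measure// lee_fin.
  by apply: le_trans (ltW muN); exact: ler_norm.
(* Every backward orbit has a point whose value is within [1 / (N + 1)] of the infimum of [f] along
   it, and such a point lies in [B N]. *)
move=> x Lx; pose E := [set f (iter j V x) | j in [set: nat]].
have infE : has_inf E.
  by split; [exists (f x), 0%N|exists 0 => _ [j _ <-]].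
have d0 : 0 < (N.+1%:R^-1 : R) by rewrite invr_gt0.
have [_ [j _ <-] jinf] := inf_adherent d0 infE.
exists j; split=> [|i]; first by elim: j {jinf} => //= j; exact: LV.
apply: le_trans (ltW jinf) _; rewrite lerD2r; apply: ge_inf; first by case: infE.
by exists (i + j)%N => //; rewrite iterD.
Qed.

(** * Cycles from towers *)

(** A pointwise form of an n-cycle with support [G], in which [iter n.-1 P] is the inverse of
    [P]. *)
Definition ncycle_on {X : Type} (n : nat) (P : X -> X) (G : set X) : Prop :=
  [/\ forall x, iter n P x = x, forall x, ~ G x -> P x = x &
    forall x i, G x -> (0 < i < n)%N -> iter i P x <> x].

Definition level {X : Type} (V : X -> X) (B : set X) (n : nat) (x : X) : nat :=
  (least (fun j => B (iter j V x)) %% n)%N.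

(* Counting from the last visit to B, the U-orbit is cut into blocks of n points; the tower
   consists of the blocks that are complete before the next visit to B. *)
Definition tower {X : Type} (U V : X -> X) (L B : set X) (n : nat) : set X :=
  [set x | L x /\ forall m, (0 < m < n - level V B n x)%N -> ~ B (iter m U x)].

Definition tower_cycle {X : Type} (U V : X -> X) (L B : set X) (n : nat) (x : X) : X :=
  if `[< tower U V L B n x >] then
    if `[< (level V B n x < n.-1)%N >] then U x else iter n.-1 V x
  else x.

(** Below the top level [U x] is not in [B], so the distance to the last visit grows by one without
    wrapping modulo [n]; the block still ends at the same place. *)
Lemma tower_up {X : Type} (U V : X -> X) (L B : set X) n x :
  cancel U V -> (forall x, L x -> L (U x)) ->
  (forall x, L x -> exists j, B (iter j V x)) ->
  tower U V L B n x -> (level V B n x < n.-1)%N ->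
  tower U V L B n (U x) /\ level V B n (U x) = (level V B n x).+1.
Proof.
move=> UK LU hit [Lx Gx] rn.
have [Bb bmin] := leastP (hit x Lx).
have lE : level V B n (U x) = (level V B n x).+1.
  rewrite /level (least_eq (k := (least (fun j => B (iter j V x))).+1)).
  - rewrite -addn1 -modnDml modn_small ?addn1//.
    by rewrite /level in rn; case: (n) rn => //=; rewrite ltn0.
  - by rewrite iterSr UK.
  (* That [U x] is outside [B] is the tower condition for [m = 1], in range because the level is
     below [n - 1]. *)
  - move=> [_|i ib] /=; last by rewrite -iterS iterSr UK; exact: bmin.
    by apply: (Gx 1%N); rewrite /= ltn_subRL addn1 -ltn_predRL.
split=> //; split=> [|m]; first exact: LU.
rewrite lE => /andP[m0 mn]; rewrite -iterSr; apply: Gx => /=.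
by move: mn; rewrite !ltn_subRL addSnnS.
Qed.

(** Going back by at most the level does not pass the last visit to [B]. The points met on the way
    avoid [B] by minimality of that visit; those after [x] avoid it by the tower condition at
    [x]. *)
Lemma tower_down {X : Type} (U V : X -> X) (L B : set X) n x i :
  cancel V U -> (forall x, L x -> L (V x)) ->
  (forall x, L x -> exists j, B (iter j V x)) ->
  tower U V L B n x -> (i <= level V B n x)%N ->
  tower U V L B n (iter i V x) /\ level V B n (iter i V x) = (level V B n x - i)%N.
Proof.
move=> VK LV hit [Lx Gx] ir.
have [Bb bmin] := leastP (hit x Lx).
have ib : (i <= least (fun j => B (iter j V x)))%N.
  by apply: leq_trans ir _; exact: leq_mod.
have lE : level V B n (iter i V x) = (level V B n x - i)%N.
  rewrite /level (least_eq (k := (least (fun j => B (iter j V x)) - i)%N)).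
  - case: (posnP n) ir => [->|n0 ir]; first by rewrite !modn0.
    rewrite {1}(divn_eq (least (fun j => B (iter j V x))) n) -addnBA// modnMDl.
    by rewrite modn_small// (leq_ltn_trans (leq_subr _ _))// ltn_mod.
  - by rewrite -iterD subnK.
  - by move=> j jb; rewrite -iterD; apply: bmin; rewrite addnC -ltn_subRL.
split=> //; split=> [|m]; first by elim: (i) => //= k; exact: LV.
rewrite lE => /andP[m0 mn]; case: (leqP m i) => [mi|im].
  rewrite iter_cancelB//; apply: bmin; apply: leq_trans ib.
  by rewrite ltn_subrL m0 (leq_trans m0 mi).
rewrite -(subnK (ltnW im)) iterD (iter_cancel _ VK); apply: Gx.
by move: (level V B n x) ir mn im => r; lia.
Qed.

(** Each application of [P] raises the level by one modulo [n], which excludes an earlier return.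
    From level 0, [P] follows [U] for [n - 1] steps and then comes back. *)
Lemma tower_cycleP {X : Type} (U V : X -> X) (L B : set X) n :
  (1 < n)%N -> cancel U V -> cancel V U ->
  (forall x, L x -> L (U x)) -> (forall x, L x -> L (V x)) ->
  (forall x, L x -> exists j, B (iter j V x)) ->
  ncycle_on n (tower_cycle U V L B n) (tower U V L B n).
Proof.
move=> n1 UK VK LU LV hit.
set P := tower_cycle U V L B n; set G := tower U V L B n; set r := level V B n.
have n0 : (0 < n)%N by exact: ltnW.
have rn x : (r x <= n.-1)%N by rewrite -ltnS prednK// ltn_mod.
have PU x : G x -> (r x < n.-1)%N -> P x = U x.
  by move=> Gx rx; rewrite /P /tower_cycle !asboolT.
have PV x : G x -> r x = n.-1 -> P x = iter n.-1 V x.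
  by move=> Gx rx; rewrite /P /tower_cycle asboolT// asboolF// -/r rx ltnn.
have step x : G x -> G (P x) /\ r (P x) = ((r x).+1 %% n)%N.
  move=> Gx; have := rn x; rewrite leq_eqVlt => /orP[/eqP rx|rx].
    have [] := tower_down VK LV hit Gx (eq_leq (esym rx)).
    by rewrite PV// -/r rx subnn prednK// modnn.
  have [] := tower_up UK LU hit Gx rx.
  by rewrite PU// -/r => ? ->; rewrite modn_small// -ltn_predRL.
have stepi i x : G x -> G (iter i P x) /\ r (iter i P x) = ((r x + i) %% n)%N.
  move=> Gx; elim: i => [|i [Gi ri]] /=.
    by rewrite addn0 modn_small// -[X in (_ < X)%N](prednK n0) ltnS.
  have [GP ->] := step _ Gi; split=> //.
  by rewrite ri -addn1 modnDml addn1 addnS.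
have base z : G z -> r z = 0%N -> forall i, (i <= n.-1)%N -> iter i P z = iter i U z.
  move=> Gz rz; elim=> // i IH i_n.
  have [Gi ri] := stepi i z Gz.
  rewrite !iterS -IH ?(ltnW i_n)// PU// ri rz add0n modn_small//.
  by rewrite (leq_trans i_n)// leq_pred.
have basen z : G z -> r z = 0%N -> iter n P z = z.
  move=> Gz rz; have [Gi ri] := stepi n.-1 z Gz.
  rewrite -{1}(prednK n0) iterS PV//; last first.
    by rewrite ri rz add0n modn_small// prednK.
  by rewrite base// (iter_cancel _ UK).
split.
- move=> x; have [Gx|Gx] := pselect (G x); last first.
    by elim: (n) => //= m ->; rewrite /P /tower_cycle asboolF.
  (* The period is known at the base of the block; [x] is reached from there by [r x] applications
     of [P], which commute with [iter n P]. *)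
  have [Gz] := tower_down VK LV hit Gx (leqnn (r x)).
  rewrite -/r subnn => rz.
  have <- : iter (r x) P (iter (r x) V x) = x.
    by rewrite base// (iter_cancel _ VK).
  by rewrite -iterD addnC iterD basen.
- by move=> x Gx; rewrite /P /tower_cycle asboolF.
- move=> x i Gx /andP[i0 i_n] Px.
  have [_] := stepi i x Gx; rewrite Px => /eqP.
  have rxn : (r x < n)%N by rewrite ltn_mod.
  rewrite -{1}(modn_small rxn) -{1}[r x]addn0 eqn_modDl mod0n modn_small//.
  by rewrite eq_sym -leqn0 leqNgt i0.
Qed.

(** The missed points are thus covered by [n] preimages of [B], so their measure is at most [n]
    times that of [B]. *)
Lemma not_tower {X : Type} (U V : X -> X) (L B : set X) n x :
  L x -> ~ tower U V L B n x -> exists m, (m < n)%N /\ B (iter m U x).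
Proof.
move=> Lx Gx; apply: contrapT => /forallNP H; apply: Gx; split=> // m /andP[_ mn] Bm.
by apply: (H m); split=> //; apply: leq_trans mn _; exact: leq_subr.
Qed.

(** * Integral bounds and one round of the construction *)

Lemma integral_mpreserving {d} {X : measurableType d} {R : realType}
    (mu : {measure set X -> \bar R}) (U : X -> X) (g : X -> \bar R) :
  mpreserving mu U -> measurable_fun setT g -> (forall x, (0 <= g x)%E) ->
  (\int[mu]_x g (U x) = \int[mu]_x g x)%E.
Proof.
move=> [mU muU] mg g0.
have := @ge0_integral_pushforward _ _ _ _ R U mU mu setT g measurableT mg
  (fun x _ => g0 x).
rewrite preimage_setT => <-.
by apply: eq_measure_integral => A mA _; exact: muU.
Qed.

Lemma metric_compatible_sum {R : realType} (phi : R -> R) (F : nat -> nat) m :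
  metric_compatible phi ->
  phi (\sum_(i < m) F i)%N%:R <= \sum_(i < m) phi (F i)%:R.
Proof.
move=> [_ [phiD [_ [phi0 _]]]]; elim: m => [|m IH].
  by rewrite !big_ord0 phi0.
rewrite !big_ord_recr /= natrD; apply: le_trans (phiD _ _ _ _) _; rewrite ?ler0n//.
by rewrite lerD2r.
Qed.

(** Integrate the affine majorant: Kac bounds the linear term by [h]. Outside [L] the return time is
    0 and [phi 0 = 0], so the constant is paid only on [L]. *)
Lemma integral_return_time {d} {X : measurableType d} {R : realType}
    (mu : probability X R) (phi : R -> R) (T S : X -> X) (L : set X) (h C : R) :
  metric_compatible phi -> pmp_pair mu T S -> measurable L -> recurrent T L ->
  0 <= h -> 0 <= C -> (forall t, 0 <= t -> phi t <= h * t + C) ->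
  (\int[mu]_x (phi (return_time T L x)%:R)%:E <= h%:E + C%:E * mu L)%E.
Proof.
move=> [phi_ge0 [_ [_ [phi0 _]]]] TS mL rL h0 C0 phile.
have ma : cmeasurable (return_time T L).
  by apply: cmeasurable_return_time => //; case: TS => -[].
have mphi (g : nat -> \bar R) : measurable_fun setT (g \o return_time T L).
  exact: cmeasurable_measurable.
have mind : measurable_fun setT (fun x => (\1_L x : R)%:E).
  by apply/measurable_EFinP; exact: measurable_indic.
apply: (@le_trans _ _
  (\int[mu]_x (h%:E * (return_time T L x)%:R%:E + C%:E * (\1_L x)%:E))%E).
  apply: ge0_le_integral => //.
  - by move=> x _; rewrite lee_fin phi_ge0.
  - exact: (mphi (fun k => (phi k%:R)%:E)).
  - apply: emeasurable_funD; first exact: (mphi (fun k => h%:E * k%:R%:E)%E).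
    exact: measurable_funeM.
  - move=> x _; rewrite -!EFinM -EFinD lee_fin.
    have [Lx|Lx] := pselect (L x); first by rewrite indicE mem_set// mulr1 phile.
    by rewrite return_time_out// phi0 indicE memNset// !mulr0 addr0.
rewrite ge0_integralD//=.
- have -> : (\int[mu]_x (h%:E * (return_time T L x)%:R%:E) =
      h%:E * \int[mu]_x (return_time T L x)%:R%:E)%E.
    apply: ge0_integralZl_EFin => //.
    exact: (mphi (fun k => k%:R%:E)).
  have -> : (\int[mu]_x (C%:E * (\1_L x)%:E) = C%:E * \int[mu]_x (\1_L x : R)%:E)%E.
    exact: ge0_integralZl_EFin.
  rewrite integral_indic// setIT leeD2r// -[leRHS]mule1.
  by apply: lee_wpmul2l; rewrite ?lee_fin//; exact: kac TS _ _.
- by move=> x _; rewrite mule_ge0// lee_fin.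
- exact: (mphi (fun k => h%:E * k%:R%:E)%E).
- by move=> x _; rewrite mule_ge0// lee_fin.
- exact: measurable_funeM.
Qed.

Lemma cmeasurable_comp2 {d} {X : measurableType d} {C C' D : countType}
    (h : C -> C' -> D) (f : X -> C) (g : X -> C') :
  cmeasurable f -> cmeasurable g -> cmeasurable (fun x => h (f x) (g x)).
Proof.
move=> mf mg; apply: (cmeasurable_glue (F := fun k x => h k (g x))) => // k.
exact: (cmeasurable_comp (h k)).
Qed.

Lemma cmeasurable_sum {d} {X : measurableType d} (F : nat -> X -> nat) m :
  (forall i, cmeasurable (F i)) -> cmeasurable (fun x => \sum_(i < m) F i x)%N.
Proof.
move=> mF; elim: m => [|m IH] k.
  by under eq_fun do rewrite big_ord0; exact: cmeasurable_const.
by under eq_fun do rewrite big_ord_recr /=; exact: cmeasurable_comp2.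
Qed.

Lemma iterZ_opp {X : Type} (T S : X -> X) m x : iterZ T S (- Posz m) x = iter m S x.
Proof. by case: m. Qed.

Lemma measure_exists_lt {d} {X : measurableType d} {R : realType}
    (mu : {measure set X -> \bar R}) (Q : nat -> X -> Prop) n (e : R) :
  (forall m, measurable [set x | Q m x]) ->
  (forall m, (mu [set x | Q m x] <= e%:E)%E) ->
  (mu [set x | exists m, (m < n)%N /\ Q m x] <= (n%:R * e)%:E)%E.
Proof.
move=> mQ Qe; have -> : [set x | exists m, (m < n)%N /\ Q m x] =
    \big[setU/set0]_(m < n) [set x | Q m x].
  apply/seteqP; split=> x; rewrite -bigcup_mkord; first by move=> [m []]; exists m.
  by move=> [m /= mn Qm]; exists m.
apply: le_trans (Boole_inequality _ _) _; first by move=> i _; exact: mQ.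
apply: (@le_trans _ _ (\sum_(i < n) e%:E)%E); first by apply: lee_sum => i _; exact: Qe.
by rewrite sumEFin sumr_const card_ord mulr_natl.
Qed.

(** One round on [L0]. The cost bound is stated for every affine majorant of [phi], so that the
    slope can be chosen anew in each round. *)
Lemma cycle_step {d} {X : measurableType d} {R : realType}
    (mu : probability X R) (phi : R -> R) (T S : X -> X) (f : X -> R) (n : nat)
    (L0 : set X) (e : R) :
  metric_compatible phi -> pmp_pair mu T S ->
  measurable_fun setT f -> injective f -> (forall x, 0 <= f x) -> (1 < n)%N ->
  measurable L0 -> (forall x j, L0 x -> iter j.+1 T x <> x) -> 0 < e ->
  exists (P : X -> X) (G : set X) (c : X -> int),
    [/\ ncycle_on n P G, measurable G, G `<=` L0 & (mu (L0 `\` G) <= e%:E)%E] /\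
    [/\ cmeasurable c, forall x, P x = iterZ T S (c x) x &
      forall h C, 0 <= h -> 0 <= C -> (forall t, 0 <= t -> phi t <= h * t + C) ->
      (\int[mu]_x (phi (`|c x|%:~R))%:E <= n%:R%:E * (h%:E + C%:E * mu L0))%E].
Proof.
move=> mphi TS mf injf f0 n1 mL0 fL0 e0.
have [L [mL LL0 L0L rT rS]] := recurrent_part TS mL0.
have fL x j : L x -> iter j.+1 T x <> x by move=> /LL0; exact: fL0.
pose U := induced_map T L; pose V := induced_map S L.
have UV : pmp_pair mu U V by exact: pmp_pair_induced.
have [[mU muU] mV UK VK] := UV; have [mpV _ _ _] := pmp_pairC UV.
have LU x : L x -> L (U x) by move=> /(return_timeP rT)[].
have LV x : L x -> L (V x) by move=> /(return_timeP rS)[].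
have fU x j : L x -> iter j.+1 U x <> x.
  by move=> Lx; exact: induced_map_free.
have n0 : 0 < (n%:R : R) by rewrite ltr0n ltnW.
(* Measure [e / n] for the marker leaves at most [e] uncovered. *)
have [B [mB Be hit]] := small_marker UV mL LV fU mf injf f0 (divr_gt0 e0 n0).
have mBU m : measurable [set x | B (iter m U x)].
  by apply: measurable_preimage => //; exact: measurable_iter.
have mr : cmeasurable (level V B n).
  apply: (cmeasurable_comp (modn^~ n)); apply: cmeasurable_least => j.
  by apply: measurable_preimage => //; exact: measurable_iter.
pose G := tower U V L B n.
have mG : measurable G.
  apply: measurable_conj => //; apply: measurable_forall => m.
  apply: measurable_imply; last exact: measurable_negation.
  exact: (cmeasurable_preimage (fun k => (0 < m < n - k)%N : Prop)).
pose a := return_time T L; pose a' := return_time S L.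
have ma : cmeasurable a by apply: cmeasurable_return_time => //; case: TS => -[].
have ma' : cmeasurable a' by apply: cmeasurable_return_time => //; case: TS.
pose s x := (\sum_(i < n.-1) a' (iter i V x))%N.
have ma'V i : cmeasurable (fun x => a' (iter i V x)).
  by apply: cmeasurable_precomp => //; exact: measurable_iter.
have ms : cmeasurable s by exact: (cmeasurable_sum (F := fun i x => a' (iter i V x))).
(* At the top of a block the cycle goes back [n - 1] steps of the induced map, hence minus the sum
   of the backward return times. *)
pose c x := if `[< G x >] then
    if `[< (level V B n x < n.-1)%N >] then Posz (a x) else - Posz (s x)
  else 0.
have mc : cmeasurable c.
  apply: cmeasurable_ite => //; last exact: cmeasurable_const.
  apply: cmeasurable_ite.
  - exact: (cmeasurable_preimage (fun k => (k < n.-1)%N : Prop)).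
  - exact: (cmeasurable_comp Posz).
  - exact: (cmeasurable_comp (fun k => - Posz k)).
exists (tower_cycle U V L B n), G, c; split; split=> //.
- exact: tower_cycleP.
- by move=> x [/LL0].
- pose Z := [set x | exists m, (m < n)%N /\ B (iter m U x)].
  have mZ : measurable Z.
    apply: measurable_exists => m; apply: measurable_conj => //.
    exact: measurable_const.
  have mD : measurable (L0 `\` L) by exact: measurableD.
  apply: (@le_trans _ _ (mu (Z `|` (L0 `\` L)))).
    apply: le_measure; rewrite ?inE; [exact: measurableD|exact: measurableU|].
    move=> x [L0x Gx]; have [Lx|Lx] := pselect (L x); last by right.
    by left; exact: not_tower Gx.
  rewrite measureU0// -[in leRHS](divfK (lt0r_neq0 n0) e) mulrC.
  apply: measure_exists_lt => // m.
  have [[_ muUm] _ _ _] := pmp_pair_iter m UV.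
  apply: le_trans Be; rewrite le_eqVlt; apply/orP; left; apply/eqP; exact: muUm.
- move=> x; rewrite /tower_cycle /c -/G; case: ifP => // _; case: ifP => // _.
  by rewrite iterZ_opp; exact: iter_piecewise.
move=> h C h0 C0 phile.
have [phi_ge0 [_ [_ [phi0 _]]]] := mphi.
(* The forward return at index 0 and [n - 1] backward returns: these [n] terms together dominate
   both cases of the cocycle. *)
pose g i x := if i is j.+1 then phi (a' (iter j V x))%:R else phi (a x)%:R.
have mg i : measurable_fun setT (fun x => (g i x)%:E).
  case: i => [|i].
    exact: (cmeasurable_measurable (fun k => (phi k%:R)%:E) ma).
  exact: (cmeasurable_measurable (fun k => (phi k%:R)%:E) (ma'V i)).
have g0 i x : 0 <= g i x by case: i => *; exact: phi_ge0.
have cg x : phi (`|c x|%:~R) <= \sum_(i < n) g i x.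
  rewrite -(prednK (ltnW n1)) big_ord_recl /=.
  have sg : 0 <= \sum_(i < n.-1) phi (a' (iter i V x))%:R.
    by apply: sumr_ge0 => i _; exact: phi_ge0.
  rewrite /c; case: ifP => _; last by rewrite normr0 phi0 addr_ge0// phi_ge0.
  case: ifP => _; first by rewrite lerDl.
  rewrite normrN; apply: (@le_trans _ _ (\sum_(i < n.-1) phi (a' (iter i V x))%:R)).
    exact: (metric_compatible_sum (fun i => a' (iter i V x)) n.-1 mphi).
  by rewrite lerDr phi_ge0.
apply: (@le_trans _ _ (\int[mu]_x (\sum_(i < n) (g i x)%:E))%E).
  apply: ge0_le_integral => //.
  - by move=> x _; rewrite lee_fin phi_ge0.
  - exact: (cmeasurable_measurable (fun k : int => (phi (`|k|%:~R))%:E) mc).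
  - exact: emeasurable_sum.
  - by move=> x _; rewrite sumEFin lee_fin.
have muL : (h%:E + C%:E * mu L <= h%:E + C%:E * mu L0)%E.
  by rewrite leeD2l// lee_wpmul2l ?lee_fin// le_measure ?inE.
rewrite ge0_integral_sum//; last by move=> i x _; rewrite lee_fin.
apply: (@le_trans _ _ (\sum_(i < n) (h%:E + C%:E * mu L0))%E); last first.
  by rewrite sumr_const card_ord mule_natl.
apply: lee_sum => i _; apply: le_trans muL.
case: (nat_of_ord i) => [|j] /=; first exact: (integral_return_time mphi TS).
(* Since [V] preserves the measure, every backward return has the same expected cost. *)
have [mpVi _ _ _] := pmp_pair_iter j (pmp_pairC UV).
rewrite (integral_mpreserving (g := fun x => (phi (a' x)%:R)%:E) mpVi).
- exact: (integral_return_time mphi (pmp_pairC TS)).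
- exact: (cmeasurable_measurable (fun k => (phi k%:R)%:E) ma').
- by move=> x; rewrite lee_fin phi_ge0.
Qed.

(** * Regularization and gluing *)

Lemma measure_eq_off_null {d} {X : measurableType d} {R : realType}
    (mu : {measure set X -> \bar R}) (A B N : set X) :
  measurable A -> measurable B -> measurable N -> mu N = 0%E ->
  (forall x, ~ N x -> (A x <-> B x)) -> mu A = mu B.
Proof.
move=> mA mB mN N0 AB; rewrite -(measureU0 mA mN N0) -(measureU0 mB mN N0).
congr (mu _); apply/seteqP; split=> x [Hx|]; do ?[by right].
all: have [Nx|Nx] := pselect (N x); first by right.
all: by left; apply/AB.
Qed.

Lemma iter_mod {X : Type} (T : X -> X) x p m :
  iter p T x = x -> iter m T x = iter (m %% p) T x.
Proof.
move=> Tp; rewrite {1}(divn_eq m p) addnC iterD.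
suff -> : iter (m %/ p * p) T x = x by [].
by elim: (m %/ p)%N => // k IH; rewrite mulSn iterD IH.
Qed.

(** Put the points where [T] and [S] are not inverse or the orbit is finite into an invariant null
    set, and replace both maps there by the identity. Off it, a periodic point would have a finite
    orbit. *)
Lemma aperiodic_regularize {d} {X : measurableType d} {R : realType}
    (mu : {measure set X -> \bar R}) (T S : X -> X) :
  mpreserving mu T -> mp_inverse mu T S ->
  {ae mu, forall x, infinite_set (orbitZ T S x)} ->
  exists (N : set X) (T' S' : X -> X),
    [/\ measurable N, mu N = 0%E, pmp_pair mu T' S',
      forall x k, ~ N x -> iterZ T' S' k x = iterZ T S k x &
      forall x j, ~ N x -> iter j.+1 T' x <> x].
Proof.
move=> mpT [mpS [[N1 [mN1 N10 sN1]] [N2 [mN2 N20 sN2]]]] [N3 [mN3 N30 sN3]].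
have [N [mN N0 sN iN]] := null_saturation mpT mpS
  (measurableU _ _ mN1 (measurableU _ _ mN2 mN3))
  (null_setU mN1 (measurableU _ _ mN2 mN3) N10 (null_setU mN2 mN3 N20 N30)).
have inf x : ~ N x -> infinite_set (orbitZ T S x).
  by move=> Nx; apply: contrapT => H; apply: Nx; apply: sN; right; right; exact: sN3.
have ST x : ~ N x -> S (T x) = x.
  by move=> Nx; apply: contrapT => H; apply: Nx; apply: sN; left; exact: sN1.
have TS x : ~ N x -> T (S x) = x.
  by move=> Nx; apply: contrapT => H; apply: Nx; apply: sN; right; left; exact: sN2.
pose reg (U : X -> X) x := if `[< N x >] then x else U x.
have regN U x : ~ N x -> reg U x = U x by move=> Nx; rewrite /reg asboolF.
have mreg U : measurable_fun setT U -> measurable_fun setT (reg U).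
  by move=> mU; apply: measurable_ite => //; exact: measurable_id.
have mpreg U : mpreserving mu U -> mpreserving mu (reg U).
  move=> [mU muU]; split=> [|A mA]; first exact: mreg.
  rewrite -(muU A mA); apply: (measure_eq_off_null (N := N)) => //.
  - by apply: measurable_preimage => //; exact: mreg.
  - exact: measurable_preimage.
  - by move=> x Nx; rewrite /= regN.
have regK U V : (forall x, ~ N x -> ~ N (U x)) -> (forall x, ~ N x -> V (U x) = x) ->
    cancel (reg U) (reg V).
  move=> NU VU x; have [Nx|Nx] := pselect (N x); first by rewrite /reg !asboolT.
  by rewrite regN// regN ?VU//; exact: NU.
have TSreg : pmp_pair mu (reg T) (reg S).
  split; [exact: mpreg|by apply: mreg; case: mpS|apply: regK => // x /iN[]//..].
have iterN U m x : (forall x, ~ N x -> ~ N (U x)) -> ~ N x ->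
    ~ N (iter m U x) /\ iter m (reg U) x = iter m U x.
  move=> NU Nx; elim: m => //= m [Nm ->]; split; first exact: NU.
  exact: regN.
have iterZN x k : ~ N x -> iterZ (reg T) (reg S) k x = iterZ T S k x.
  move=> Nx; case: k => m /=; first by apply: (iterN _ _ _ _ Nx).2 => y /iN[].
  by apply: (iterN S m.+1 x _ Nx).2 => y /iN[].
exists N, (reg T), (reg S); split=> // x j Nx Tx.
apply: (inf x Nx).
apply: (@sub_finite_set _ _ ((fun i => iter i (reg T) x) @` `I_j.+1)); last first.
  exact/finite_image/finite_II.
move=> _ [k _ <-]; rewrite -iterZN//.
suff [m ->] : exists m, iterZ (reg T) (reg S) k x = iter m (reg T) x.
  by exists (m %% j.+1)%N; [exact: ltn_pmod|rewrite -iter_mod].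
case: k => m; first by exists m.
(* A multiple of the period that is at least [m + 1] turns the negative power into a forward one. *)
exists (m.+1 * j.+1 - m.+1)%N; rewrite /iterZ.
have [_ _ TK _] := TSreg.
have {1}<- : iter (m.+1 * j.+1) (reg T) x = x by rewrite (iter_mod _ Tx) modnMl.
by rewrite iter_cancelB// leq_pmulr.
Qed.

(** Beyond a threshold sublinearity gives [phi t <= h * t]; up to it, monotonicity bounds [phi] by
    its value at the threshold. *)
Lemma sublinear_bound {R : realType} (phi : R -> R) (h : R) :
  metric_compatible phi -> sublinear phi -> 0 < h ->
  exists C, 0 <= C /\ forall t, 0 <= t -> phi t <= h * t + C.
Proof.
move=> [phi_ge0 [_ [phi_le _]]] /cvgrPdist_lt /(_ h) sub h0.
have [M [_ HM]] := sub h0.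
pose M' := Num.max M 0; have M'0 : 0 <= M' by rewrite le_max lexx orbT.
exists (phi M'); split=> [|t t0]; first exact: phi_ge0.
have [tM|Mt] := leP t M'.
  by apply: le_trans (phi_le _ _ t0 tM) _; rewrite lerDr mulr_ge0// ltW.
have tpos : 0 < t by exact: le_lt_trans Mt.
have := HM t; rewrite /= sub0r normrN => /(_ (le_lt_trans _ Mt)).
rewrite le_max lexx => /(_ isT) /ltW /(le_trans (ler_norm _)).
rewrite ler_pdivrMr// => /le_trans; apply; rewrite lerDl; exact: phi_ge0.
Qed.

(** * Gluing disjoint cycles and exhausting a set *)

Definition glue {X Y : Type} (G : nat -> set X) (P : nat -> X -> Y) (P0 : X -> Y) (x : X) : Y :=
  if `[< exists k, G k x >] then P (least (fun k => G k x)) x else P0 x.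

Lemma glueP {X Y : Type} (G : nat -> set X) (P : nat -> X -> Y) (P0 : X -> Y) x k :
  (forall i j x, G i x -> G j x -> i = j) -> G k x -> glue G P P0 x = P k x.
Proof.
move=> dG Gk; have ex : exists k, G k x by exists k.
by rewrite /glue asboolT// (dG _ _ _ (leastP ex).1 Gk).
Qed.

Lemma glue_out {X Y : Type} (G : nat -> set X) (P : nat -> X -> Y) (P0 : X -> Y) x :
  ~ (exists k, G k x) -> glue G P P0 x = P0 x.
Proof. by move=> Gx; rewrite /glue asboolF. Qed.

(** If [P x] left [G] it would be fixed, so [x = iter n P x] would equal [P x], against freeness on
    [G]. *)
Lemma ncycle_on_in {X : Type} n (P : X -> X) (G : set X) x :
  (1 < n)%N -> ncycle_on n P G -> G x -> G (P x).
Proof.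
move=> n1 [Pn Pout Pfree] Gx; apply: contrapT => /Pout PP.
apply: (Pfree x 1%N) => //=.
by rewrite -{2}(Pn x) -(prednK (ltnW n1)) iterSr; elim: n.-1 => //= m <-.
Qed.

Lemma ncycle_on_glue {X : Type} n (G : nat -> set X) (P : nat -> X -> X) :
  (1 < n)%N -> (forall i j x, G i x -> G j x -> i = j) ->
  (forall k, ncycle_on n (P k) (G k)) ->
  ncycle_on n (glue G P id) [set x | exists k, G k x].
Proof.
move=> n1 dG PG.
have iterE k x i : G k x -> G k (iter i (P k) x) /\ iter i (glue G P id) x = iter i (P k) x.
  move=> Gx; elim: i => //= i [Gi ->]; split; first exact: ncycle_on_in (PG k) _.
  exact: glueP.
split=> [x|x Gx|x i [k Gx] i_n].
- have [[k Gx]|Gx] := pselect (exists k, G k x).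
    by rewrite (iterE k x n Gx).2; case: (PG k).
  by elim: (n) => //= m ->; rewrite glue_out.
- by rewrite glue_out.
- by rewrite (iterE k x i Gx).2; case: (PG k) => _ _; exact.
Qed.

Lemma iter_iter {X : Type} (P : X -> X) k m x : iter k (iter m P) x = iter (k * m) P x.
Proof. by elim: k => //= k ->; rewrite mulSn iterD. Qed.

(** Negative powers are forward powers of [P], so the orbit is the image of the first [n] exponents:
    injective on [G], constant off it. *)
Lemma card_orbit_ncycle {X : Type} n (P : X -> X) (G : set X) x :
  (1 < n)%N -> ncycle_on n P G ->
  (orbitZ P (iter n.-1 P) x #= `I_1)%card \/ (orbitZ P (iter n.-1 P) x #= `I_n)%card.
Proof.
move=> n1 [Pn Pout Pfree].
have orbE : orbitZ P (iter n.-1 P) x = (fun i => iter i P x) @` `I_n.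
  apply/seteqP; split=> _ [k kn <-]; last by exists (Posz k).
  suff [m ->] : exists m, iterZ P (iter n.-1 P) k x = iter m P x.
    exists (m %% n)%N; first by rewrite /= ltn_mod ltnW.
    by rewrite -(iter_mod _ (Pn x)).
  case: k {kn} => m; first by exists m.
  by exists (m.+1 * n.-1)%N; rewrite -iter_iter.
rewrite orbE; have [Gx|Gx] := pselect (G x); [right|left].
  apply: inj_card_eq => i j; rewrite !inE /=.
  wlog ij : i j / (i <= j)%N.
    move=> H i_n j_n E; case/orP: (leq_total i j) => [ij|ji]; first exact: H.
    by apply/esym/H.
  move=> i_n j_n E; move: ij; rewrite leq_eqVlt => /orP[/eqP //|ij].
  case: (Pfree x (j - i)%N Gx).
    by rewrite subn_gt0 ij (leq_ltn_trans (leq_subr _ _)).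
  (* Completing [i] to a full period turns the coincidence into a return at time [j - i]. *)
  have := congr1 (iter (n - i) P) E.
  rewrite -!iterD subnK ?(ltnW i_n)// Pn => {2}->.
  by rewrite -{1}(Pn x) -iterD; congr (iter _ P x); lia.
have fx i : iter i P x = x by elim: i => //= i ->; exact: Pout.
suff -> : (fun i => iter i P x) @` `I_n = (fun=> x) @` `I_1.
  by apply: inj_card_eq => i j; rewrite !inE /=; case: i => [|//]; case: j.
apply/seteqP; split=> _ [i _ <-].
  by exists 0%N.
by exists 0%N; [exact: ltnW|].
Qed.

(** Each round works on what the previous ones left. The leftover is made small relative to the
    constant of the next round, whose slope is halved, so the costs are summable. *)
Lemma cycle_exhaustion {d} {X : measurableType d} {R : realType}
    (mu : probability X R) (phi : R -> R) (T S : X -> X) (f : X -> R) (n : nat)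
    (L0 : set X) :
  metric_compatible phi -> sublinear phi -> pmp_pair mu T S ->
  measurable_fun setT f -> injective f -> (forall x, 0 <= f x) -> (1 < n)%N ->
  measurable L0 -> (forall x j, L0 x -> iter j.+1 T x <> x) ->
  exists (P : X -> X) (G : set X) (c : X -> int),
    [/\ ncycle_on n P G, measurable G, G `<=` L0 & mu (L0 `\` G) = 0%E] /\
    [/\ cmeasurable c, forall x, P x = iterZ T S (c x) x &
      (\int[mu]_x (phi (`|c x|%:~R))%:E < +oo)%E].
Proof.
move=> mphi sphi TS mf injf f0 n1 mL0 fL0.
have [phi_ge0 [_ [_ [phi0 _]]]] := mphi.
pose h k : R := (2 ^ k.+1)%:R^-1.
have h0 k : 0 < h k by rewrite invr_gt0 ltr0n expn_gt0.
have [C HC] := choice (fun k => sublinear_bound mphi sphi (h0 k)).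
(* Chosen so that [C k.+1] times the measure left after round [k] is at most [h k.+1]. *)
pose e k := h k.+1 / (1 + C k.+1).
have C1 k : 0 < 1 + C k by rewrite ltr_pwDl// (HC k).1.
have e0 k : 0 < e k by rewrite divr_gt0.
pose good (k : nat) (L : set X) (D : (X -> X) * set X * (X -> int)) :=
  [/\ ncycle_on n D.1.1 D.1.2, measurable D.1.2, D.1.2 `<=` L &
    (mu (L `\` D.1.2) <= (e k)%:E)%E] /\
  [/\ cmeasurable D.2, forall x, D.1.1 x = iterZ T S (D.2 x) x &
    forall h C, 0 <= h -> 0 <= C -> (forall t, 0 <= t -> phi t <= h * t + C) ->
    (\int[mu]_x (phi (`|D.2 x|%:~R))%:E <= n%:R%:E * (h%:E + C%:E * mu L))%E].
(* The conditions on the set are placed under the existential, so that the choice is a total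
   function; elsewhere it takes a dummy value. *)
have /choice[D HD] : forall kL : nat * set X, exists D,
    measurable kL.2 -> kL.2 `<=` L0 -> good kL.1 kL.2 D.
  move=> [k L]; have [[mL LL0]|] := pselect (measurable L /\ L `<=` L0).
    have fL x j : L x -> iter j.+1 T x <> x by move=> /LL0; exact: fL0.
    have [P [G [c [H1 H2]]]] := cycle_step mphi TS mf injf f0 n1 mL fL (e0 k).
    by exists (P, G, c).
  by move=> H; exists (id, set0, fun=> 0) => mL LL0; exfalso; exact: H.
pose L := fix L k : set X := if k is j.+1 then L j `\` (D (j, L j)).1.2 else L0.
have HL k : measurable (L k) /\ L k `<=` L0.
  elim: k => [|k [mL LL0]] /=; first by split.
  have [[_ mG _ _] _] := HD (k, L k) mL LL0.
  by split; [exact: measurableD|move=> x [/LL0]].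
have HDk k : good k (L k) (D (k, L k)) by apply: HD; case: (HL k).
pose P k := (D (k, L k)).1.1; pose G k := (D (k, L k)).1.2.
pose c k := (D (k, L k)).2.
have PG k : ncycle_on n (P k) (G k) by case: (HDk k) => -[].
have mG k : measurable (G k) by case: (HDk k) => -[].
have GL k : G k `<=` L k by case: (HDk k) => -[].
have muL k : (mu (L k.+1) <= (e k)%:E)%E by case: (HDk k) => -[].
have mc k : cmeasurable (c k) by case: (HDk k) => _ [].
have Pc k x : P k x = iterZ T S (c k x) x by case: (HDk k) => _ [_ + _]; exact.
have Ldecr i j x : (i <= j)%N -> L j x -> L i x.
  move=> ij; rewrite -(subnK ij); elim: (j - i)%N => // m IH.
  by rewrite addSn => -[Lx _]; exact: IH.
have dG i j x : G i x -> G j x -> i = j.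
  have lt_absurd i' j' : (i' < j')%N -> G i' x -> G j' x -> False.
    by move=> ij Gi /GL /(Ldecr _ _ _ ij) [_]; exact.
  move=> Gi Gj; case: (ltngtP i j) => // ij.
    by case: (lt_absurd _ _ ij Gi Gj).
  by case: (lt_absurd _ _ ij Gj Gi).
have mGT : measurable [set x | exists k, G k x] by exact: measurable_exists.
have mcT : cmeasurable (glue G c (fun=> 0)).
  apply: cmeasurable_ite => //; last exact: cmeasurable_const.
  by apply: (cmeasurable_glue (F := c)) => //; exact: cmeasurable_least.
exists (glue G P id), [set x | exists k, G k x], (glue G c (fun=> 0)).
split; split=> //.
- exact: ncycle_on_glue.
- by move=> x [k /GL]; case: (HL k) => _; exact.
- have LT k : L0 `\` [set x | exists k, G k x] `<=` L k.
    move=> x [L0x Gx]; elim: k => //= k Lk; split=> // Gk.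
    by apply: Gx; exists k.
  have mLG : measurable (L0 `\` [set x | exists k, G k x]) by exact: measurableD.
  apply/eqP; rewrite -measure_le0; apply/lee_addgt0Pr => t t0; rewrite add0e.
  (* The final leftover lies in every [L k.+1], of measure at most
     [e k <= h k.+1 <= 1 / (k + 1)]. *)
  have [k kt] : exists k, k.+1%:R^-1 < t.
    exists (Num.truncn t^-1); rewrite -[ltRHS]invrK ltf_pV2 ?posrE ?invr_gt0//.
    exact: truncnS_gt.
  apply: (@le_trans _ _ (mu (L k.+1))); first by rewrite le_measure ?inE//; case: (HL k.+1).
  apply: le_trans (muL k) _; rewrite lee_fin; apply: le_trans (ltW kt).
  rewrite /e ler_pdivrMr//; apply: (@le_trans _ _ k.+1%:R^-1).
    rewrite lef_pV2 ?posrE// ?ltr0n ?expn_gt0// ler_nat.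
    by apply: ltnW; apply: leq_ltn_trans (leqnSn _) _; exact: ltn_expl.
  by rewrite ler_peMr// lerDl (HC _).1.
- move=> x; have [[k Gx]|Gx] := pselect (exists k, G k x).
    by rewrite !(glueP _ _ dG Gx).
  by rewrite !glue_out.
pose g k x := (phi (`|c k x|%:~R))%:E.
have g0 k x : (0 <= g k x)%E by rewrite lee_fin phi_ge0.
have mg k : measurable_fun setT (g k).
  exact: (cmeasurable_measurable (fun k : int => (phi (`|k|%:~R))%:E) (mc k)).
apply: (@le_lt_trans _ _ (\int[mu]_x (\sum_(k <oo) g k x))%E).
  apply: ge0_le_integral => //.
  - by move=> x _; rewrite lee_fin phi_ge0.
  - exact: (cmeasurable_measurable (fun k : int => (phi (`|k|%:~R))%:E) mcT).
  - exact: ge0_emeasurable_sum.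
  - move=> x _; have [[k Gx]|Gx] := pselect (exists k, G k x); last first.
      by rewrite glue_out// normr0 phi0; exact: nneseries_ge0.
    rewrite (glueP _ _ dG Gx); apply: le_trans (nneseries_lim_ge k.+1 _) => //.
    by rewrite big_nat_recr//= leeDr// sume_ge0.
rewrite integral_nneseries//.
(* Later rounds cost at most [2 * n * h k]; the term with [C 0] absorbs round 0, where only
   [mu L0 <= 1] is known. *)
pose K := n%:R * (2 + 2 * C 0%N).
have K0 : 0 <= K by rewrite mulr_ge0// addr_ge0// mulr_ge0// (HC _).1.
apply: (@le_lt_trans _ _ (\sum_(k <oo) (K / (2 ^ k.+1)%:R)%:E)%E); last first.
  by apply: le_lt_trans (epsilon_trick0 _ K0) _; exact: ltry.
apply: lee_nneseries => [k _ _|k _]; first exact: integral_ge0.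
have [_ [_ _ ck]] := HDk k.
apply: le_trans (ck _ _ (ltW (h0 k)) (HC k).1 (HC k).2) _.
have [r [rk muLr]] : exists r, C k * r <= h k * (1 + 2 * C 0%N) /\ (mu (L k) <= r%:E)%E.
  case: k {ck} => [|k].
    exists 1; split; last by apply: probability_le1; case: (HL 0%N).
    by rewrite /h expn1 mulrDr !mulr1 mulrA mulVf// mul1r lerDr.
  exists (e k); split=> //; rewrite /e mulrA ler_pdivrMr// mulrC -mulrA.
  rewrite ler_pM2l//; apply: (@le_trans _ _ (1 + C k.+1)); first by rewrite lerDr.
  apply: ler_peMl; first exact: ltW.
  by rewrite lerDl mulr_ge0// (HC _).1.
apply: (@le_trans _ _ (n%:R%:E * (h k + C k * r)%:E)%E).
  apply: lee_wpmul2l; first by rewrite lee_fin.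
  by rewrite EFinD EFinM leeD2l// lee_wpmul2l// lee_fin (HC k).1.
rewrite -EFinM lee_fin /K -mulrA ler_wpM2l//.
have -> : (2 + 2 * C 0%N) / (2 ^ k.+1)%:R = h k + h k * (1 + 2 * C 0%N).
  by rewrite /h; ring.
by rewrite lerD2l.
Qed.

Theorem mainTheorem10 (R : realType) (d : measure_display) (X : measurableType d)
  (mu : probability X R) (phi : R -> R) (T : X -> X) (A : set X) (n : nat) :
  standard_borel X R -> atomless mu ->
  metric_compatible phi -> sublinear phi ->
  aperiodic mu T -> measurable A -> (2 <= n)%N ->
  exists P : X -> X,
    n_cycle mu n P /\ in_full_group_phi mu phi T P /\
    {ae mu, forall x, P x <> x <-> A x}.
Proof.
move=> [f [g [mf [_ [fK _]]]]] _ mphi sphi [mpT [S [TS inf]]] mA n1.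
have [N [T' [S' [mN N0 TS' TE free]]]] := aperiodic_regularize mpT TS inf.
(* The exponential makes the Borel isomorphism non-negative while keeping it injective, as the
   marker construction requires. *)
have mf' : measurable_fun setT (fun x => expR (f x)).
  exact: measurableT_comp.
have injf : injective (fun x => expR (f x)).
  by move=> x y /expR_inj /(can_inj fK).
have freeA x j : (A `\` N) x -> iter j.+1 T' x <> x by move=> [_ /free].
have [P [G [c [[PG mG GA AG] [mc Pc intc]]]]] := cycle_exhaustion mphi sphi TS' mf' injf
  (fun x => expR_ge0 (f x)) n1 (measurableD mA mN) freeA.
have [Pn Pout Pfree] := PG.
pose V := iter n.-1 P.
have PK : cancel P V.
  by move=> x; rewrite /V -iterSr prednK ?Pn// ltnW.
have VK : cancel V P.
  by move=> x; rewrite /V -iterS prednK ?Pn// ltnW.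
(* On each fibre of [c] the cycle is a power of [T'], hence preserves the measure. *)
have PV : pmp_pair mu P V.
  apply: (piecewise_pmp (G := iterZ T' S') (H := iterZ S' T') (c := c)) => // k.
  exact: pmp_pair_iterZ.
have mpP : mpreserving mu P by case: PV.
have invP : mp_inverse mu P V.
  by split; [case: (pmp_pairC PV)|split; apply: aeW].
have autP : isAut mu P by split=> //; exists V.
exists P; split; [|split].
- split=> //; exists V; split=> //.
  by apply: aeW => x; exact: card_orbit_ncycle PG.
- split=> //; exists S; split=> //; exists c; split=> //; split=> //.
  exists N; split=> // x /= H; apply: contrapT => Nx; apply: H.
  by rewrite Pc TE.
(* Outside the regularization set and the part of [A] missed by the exhaustion, the support [G]
   coincides with [A]. *)
- exists (N `|` ((A `\` N) `\` G)); split.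
  + by apply: measurableU => //; apply: measurableD => //; exact: measurableD.
  + by apply: null_setU => //; apply: measurableD => //; exact: measurableD.
  + move=> x /= H; apply: contrapT => /not_orP[Nx AGx]; apply: H; split=> [Px|Ax].
      by have [/GA[]//|/Pout] := pselect (G x).
    apply: (Pfree x 1%N) => //; apply: contrapT => Gx; exact: AGx.
Qed.
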